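(* Let $F(z)=z_1^2+z_2^2$ and consider the problem (Po4): minimize $F(z)$ over $z\in\Omega_0$, where $\Omega_0=\mathbf{C}\cap\{z\in\mathbb{R}^2 : z_1a+z_2b\le c\}$ and $\mathbf{C}=\{(f(x),g(x)) : x\in\mathbb{R}^n\}$ is convex, with the optimal value $v(\mathrm{Po4})$ attained at some $z^*\in\Omega_0$. Assume that the feasible domain $\Omega_0$ is either unbounded or contains an interior point. Then, for all sufficiently small $\epsilon>0$ and every approximate optimal value $\bar v\in[v(\mathrm{Po4}),v(\mathrm{Po4})+\epsilon/2]$, the bisection algorithm described in the context (run with input $\epsilon,\bar v$) terminates after $$k^*(\bar v,\epsilon)=\left[\log_2\frac{2\pi}{\arccos\frac{\sqrt{\bar v}}{\sqrt{\bar v+\epsilon/2}}}\right]+1$$ bisection steps with an approximate solution $\bar z\in\Omega_0$ such that $v(\mathrm{Po4})\le F(\bar z)\le v(\mathrm{Po4})+\epsilon$. Here $[t]$ denotes the integer part of the real number $t$.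
   Context: Setting: $f(x)=x^TPx+p^Tx+p_0$ and $g(x)=x^TQx+q^Tx+q_0$ are real quadratic functions on $\mathbb{R}^n$ ($P,Q$ symmetric, $p,q\in\mathbb{R}^n$, $p_0,q_0\in\mathbb{R}$), $a,b,c\in\mathbb{R}^m$, vector inequalities are componentwise, $v(\mathrm{Po4})=\inf\{F(z) : z\in\Omega_0\}$. $O$ denotes the origin of $\mathbb{R}^2$ and $[y,y']$ the closed line segment from $y$ to $y'$. Bisection algorithm (input $\epsilon>0$ and $\bar v\in[v(\mathrm{Po4}),v(\mathrm{Po4})+\epsilon/2]$): Step 2.1: Set $l_0=0$, $u_0=2\pi$, $k=0$, with $\Omega_0=\mathbf{C}\cap\{z\in\mathbb{R}^2 : z_1a+z_2b\le c\}$, where $\mathbf{C}=\{(f(x),g(x)) : x\in\mathbb{R}^n\}$. Step 2.2: Set $\varphi_{k+1}=\frac{l_k+u_k}{2}$ and $\Omega_{k+1}=\Omega_k\cap\{z\in\mathbb{R}^2 : (\sin\varphi_{k+1},-\cos\varphi_{k+1})z\ge 0\}$. Compute $v_{k+1}=\inf\{F(z) : z\in\Omega_{k+1}\}$. Step 2.3: If $v_{k+1}\le v(\mathrm{Po4})$, set $u_{k+1}=\varphi_{k+1}$, $l_{k+1}=l_k$. Otherwise set $u_{k+1}=u_k$, $l_{k+1}=\varphi_{k+1}$ and redefine $\Omega_{k+1}=\Omega_k\cap\{z\in\mathbb{R}^2 : (\sin\varphi_{k+1},-\cos\varphi_{k+1})z\le 0\}$. Step 2.4: Set $k:=k+1$.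 If $|u_k-l_k|>\arccos\frac{\sqrt{\bar v}}{\sqrt{\bar v+\epsilon/2}}$, go to Step 2.2. Otherwise set $\check z=(\sqrt{\bar v}\cos u_k,\sqrt{\bar v}\sin u_k)$ and $\hat z=(\sqrt{\bar v}\sec\frac{2\pi}{2^k}\cos l_k,\ \sqrt{\bar v}\sec\frac{2\pi}{2^k}\sin l_k)$. Step 2.5: If $[O,\check z]\cap\Omega_0\neq\emptyset$, let $\bar z$ be a point of $\{z : \check z_2z_1-\check z_1z_2=0\}\cap\Omega_0$ nearest to $O$; if $[O,\hat z]\cap\Omega_0\ne\emptyset$, let $\bar z$ be a point of $\{z : \hat z_2z_1-\hat z_1z_2=0\}\cap\Omega_0$ nearest to $O$. Otherwise (both intersections empty) let $\bar z$ be a point of $\{z : \check z_1z_1+\check z_2z_2=\bar v\}\cap\Omega_0$ nearest to $\check z$. Report $\bar z$.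
   Formalization: If the logarithm is an integer the algorithm stops after k*-1 steps, not k*, and this is stated. A nearest point may fail to exist when Ω_0 is not closed: the searched set is proved nonempty, every nearest point is proved good, and existence is proved for closed Ω_0. *)

(* Defs.v *)
From HB Require Import structures.
From mathcomp Require Import all_boot all_order all_algebra.
From mathcomp Require Import all_classical all_reals all_analysis.

Set Implicit Arguments.
Unset Strict Implicit.
Unset Printing Implicit Defensive.

Import Order.TTheory GRing.Theory Num.Theory.
Import numFieldNormedType.Exports.

Local Open Scope classical_set_scope.
Local Open Scope ring_scope.

Notation plane R := (R^o * R^o)%type.

Definition quadratic (R : realType) (n : nat)
    (P : 'M[R]_n) (p : 'cV[R]_n) (p0 : R) (x : 'cV[R]_n) : R :=
  (x^T *m P *m x) 0 0 + (p^T *m x) 0 0 + p0.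

Definition joint_range (R : realType) (n : nat) (f g : 'cV[R]_n -> R) :
    set (plane R) :=
  [set z | exists x : 'cV[R]_n, z = (f x, g x)].

Definition feasible (R : realType) (n m : nat) (f g : 'cV[R]_n -> R)
    (a b c : 'cV[R]_m) : set (plane R) :=
  joint_range f g `&`
  [set z | forall i, z.1 * a i 0 + z.2 * b i 0 <= c i 0].

Definition sqnorm (R : realType) (z : plane R) : R := z.1 ^+ 2 + z.2 ^+ 2.

(* Extended-real infimum, so that the value of an empty domain is +oo. *)
Definition value (R : realType) (S : set (plane R)) : \bar R :=
  ereal_inf [set (sqnorm z)%:E | z in S].

Definition segment (R : realType) (y y' : plane R) : set (plane R) :=
  [set z | exists2 t : R, 0 <= t <= 1 & z = (1 - t) *: y + t *: y'].

(* Distances in the plane are Euclidean (the norm of the product type is the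
   max norm), hence the use of [sqnorm]. *)
Definition nearest (R : realType) (S : set (plane R)) (y z : plane R) : Prop :=
  S z /\ forall w, S w -> sqnorm (z - y) <= sqnorm (w - y).

Record bisection_state (R : realType) := BisectionState {
  lo : R;
  up : R;
  dom : set (plane R) }.

Definition ray_form (R : realType) (phi : R) (z : plane R) : R :=
  sin phi * z.1 - cos phi * z.2.

Definition bisection_step (R : realType) (v : \bar R)
    (st : bisection_state R) : bisection_state R :=
  let phi := (lo st + up st) / 2 in
  let upper := dom st `&` [set z | 0 <= ray_form phi z] in
  let lower := dom st `&` [set z | ray_form phi z <= 0] in
  if (value upper <= v)%E then BisectionState (lo st) phi upper
  else BisectionState phi (up st) lower.

Definition bisection (R : realType) (Omega0 : set (plane R)) (k : nat) :
    bisection_state R :=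
  iter k (bisection_step (value Omega0)) (BisectionState 0 (2 * pi) Omega0).

Definition angle_tol (R : realType) (vbar eps : R) : R :=
  acos (Num.sqrt vbar / Num.sqrt (vbar + eps / 2)).

(* The stopping test comes after each bisection step, hence [0 < K]. *)
Definition stops_after (R : realType) (Omega0 : set (plane R)) (vbar eps : R)
    (K : nat) : Prop :=
  let width k := `|up (bisection Omega0 k) - lo (bisection Omega0 k)| in
  [/\ (0 < K)%N,
      forall k, (0 < k < K)%N -> angle_tol vbar eps < width k
    & width K <= angle_tol vbar eps].

Definition zcheck (R : realType) (Omega0 : set (plane R)) (vbar : R) (k : nat) :
    plane R :=
  let u := up (bisection Omega0 k) in
  (Num.sqrt vbar * cos u, Num.sqrt vbar * sin u).

(* sec t = (cos t)^-1.  The cosine can vanish at the stopping index only if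
   vbar = 0 (there k = 2), and then zhat is the origin as 0^-1 = 0. *)
Definition zhat (R : realType) (Omega0 : set (plane R)) (vbar : R) (k : nat) :
    plane R :=
  let l := lo (bisection Omega0 k) in
  let r := Num.sqrt vbar * (cos (2 * pi / 2 ^+ k))^-1 in
  (r * cos l, r * sin l).

(* [final_search Omega0 vbar k S y]: after k bisection steps the reported point
   is to be a point of S nearest to y.  If both segments meet Omega0, each of
   the first two searches is allowed. *)
Definition final_search (R : realType) (Omega0 : set (plane R)) (vbar : R)
    (k : nat) (S : set (plane R)) (y : plane R) : Prop :=
  let zc := zcheck Omega0 vbar k in
  let zh := zhat Omega0 vbar k in
  let meets w := segment 0 w `&` Omega0 !=set0 in
  let line w : set (plane R) := [set z | w.2 * z.1 - w.1 * z.2 = 0] in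
  [\/ [/\ meets zc, S = line zc `&` Omega0 & y = 0],
      [/\ meets zh, S = line zh `&` Omega0 & y = 0]
    | [/\ ~ meets zc, ~ meets zh,
          S = [set z | zc.1 * z.1 + zc.2 * z.2 = vbar] `&` Omega0 & y = zc]].

Definition log2_ratio (R : realType) (vbar eps : R) : R :=
  ln (2 * pi / angle_tol vbar eps) / ln 2.

Definition kstar (R : realType) (vbar eps : R) : int :=
  Num.floor (log2_ratio vbar eps) + 1.

(* Main.v *)
Require Import Defs.
From HB Require Import structures.
From mathcomp Require Import all_boot all_order all_algebra.
From mathcomp Require Import all_classical all_reals all_analysis.
From mathcomp Require Import ring lra.

(** The feasible set [Omega0] is convex in the plane, so its point [z] of least
    norm is unique, and every feasible [w] satisfies
    [sqnorm z + sqnorm (w - z) <= sqnorm w] ([least_norm_gap]).  A closed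
    half-plane through the origin that misses [z] therefore contains feasible
    points only of norm bounded away from the minimum, and the value test of a
    bisection step detects this even where infima are not attained
    ([least_norm_half_plane]).  Hence the bisection never discards [z]: after
    [k] steps [z] lies between two rays from the origin at angle
    [d = 2 * pi / 2 ^+ k] ([bisection_keeps_least_norm], [bisection_wedge]).
    The stopping test compares [d] with [angle_tol], so it first succeeds at
    the ceiling of [log2_ratio] ([stops_after_ceil]).

    At that step [cos d] is at least the square root of
    [vbar / (vbar + eps / 2)].  The rays of directions [lo] and [up] and the
    tangent at [zcheck] to the circle of radius [s = Num.sqrt vbar] bound the
    triangle with vertices [0], [zcheck], [zhat]; its farthest point from the
    origin is [zhat], of squared norm [(s / cos d) ^+ 2 <= vbar + eps / 2]
    ([sec_sqr_le], [triangle_sqnorm]), which is at most [sqnorm z + eps].  So a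
    feasible point on one of the two sides through the origin is good enough,
    and so is any feasible point on that line nearer to the origin.  (For
    [vbar = 0] the triangle shrinks to the origin, which is then [z] itself.)

    If both of these sides miss [Omega0], then [z], which is in the triangle,
    is not the only feasible point: nondegeneracy gives some [w] with
    [sqnorm z < sqnorm w], and [eps0 = sqnorm w - sqnorm z] makes [eps] so
    small that [w] is outside the triangle.  The segment from [z] to [w] then
    leaves the triangle through the third side ([tangent_side_met]).  The
    norm on the tangent line grows with the distance to [zcheck], so the
    feasible point of that line nearest to [zcheck] is good enough too
    ([sqnorm_tangent], [final_search_target]). *)

Set Implicit Arguments.
Unset Strict Implicit.
Unset Printing Implicit Defensive.

Import Order.TTheory GRing.Theory Num.Theory.
Import numFieldNormedType.Exports.

Local Open Scope classical_set_scope.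
Local Open Scope ring_scope.

(** * Coordinates along a ray *)

(** With [ray_form phi], the coordinates of [z] in the orthonormal frame whose
    first vector points in the direction [phi]. *)
Definition axial_form (R : realType) (phi : R) (z : plane R) : R :=
  cos phi * z.1 + sin phi * z.2.

Section Coordinates.
Context {R : realType}.
Implicit Types (phi r t d : R) (z w y : plane R) (h k : plane R -> R).

Lemma plane_scaleE t z : t *: z = (t * z.1, t * z.2).
Proof. by []. Qed.

Lemma plane_combE t z w :
  (1 - t) *: z + t *: w =
  ((1 - t) * z.1 + t * w.1, (1 - t) * z.2 + t * w.2).
Proof. by []. Qed.

Lemma sqnorm_ge0 z : 0 <= sqnorm z.
Proof. by rewrite addr_ge0 ?sqr_ge0. Qed.

Lemma sqnorm_frame phi z :
  sqnorm z = axial_form phi z ^+ 2 + ray_form phi z ^+ 2.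
Proof.
rewrite /sqnorm /axial_form /ray_form.
transitivity ((cos phi ^+ 2 + sin phi ^+ 2) * (z.1 ^+ 2 + z.2 ^+ 2)).
  by rewrite cos2Dsin2 mul1r.
by ring.
Qed.

Lemma ray_formB phi d z :
  ray_form (phi - d) z = cos d * ray_form phi z - sin d * axial_form phi z.
Proof. by rewrite /ray_form /axial_form sinB cosB; ring. Qed.

Lemma axial_formB phi d z :
  axial_form (phi - d) z = cos d * axial_form phi z + sin d * ray_form phi z.
Proof. by rewrite /ray_form /axial_form sinB cosB; ring. Qed.

Lemma frame_coords phi z :
  z = (axial_form phi z * cos phi + ray_form phi z * sin phi,
       axial_form phi z * sin phi - ray_form phi z * cos phi).
Proof.
case: z => z1 z2; rewrite /axial_form /ray_form /=.
have E := cos2Dsin2 phi.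
congr (_, _).
  transitivity ((cos phi ^+ 2 + sin phi ^+ 2) * z1); last by ring.
  by rewrite E mul1r.
transitivity ((cos phi ^+ 2 + sin phi ^+ 2) * z2); last by ring.
by rewrite E mul1r.
Qed.

Lemma ray_formpi z : ray_form pi z = z.2.
Proof. by rewrite /ray_form sinpi cospi; ring. Qed.

Lemma ray_form0 z : ray_form 0 z = - z.2.
Proof. by rewrite /ray_form sin0 cos0; ring. Qed.

Lemma ray_form2pi z : ray_form (2 * pi) z = - z.2.
Proof.
have -> : 2 * pi = pi + pi :> R by ring.
by rewrite /ray_form sinD cosD sinpi cospi; ring.
Qed.

Lemma segment_rayP phi r z : 0 < r -> ray_form phi z = 0 ->
  0 <= axial_form phi z <= r -> segment 0 (r * cos phi, r * sin phi) z.
Proof.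
move=> r0 z0 /andP[a0 ar]; exists (axial_form phi z / r).
  by rewrite ler_pdivrMr// mul1r ar andbT divr_ge0// ltW.
rewrite scaler0 add0r {1}(frame_coords phi z) z0.
have rn : r != 0 by rewrite gt_eqF.
by rewrite plane_scaleE /=; congr (_, _); field.
Qed.

Lemma sqnorm_segment0 w z : segment 0 w z -> sqnorm z <= sqnorm w.
Proof.
move=> [t /andP[t0 t1] ->]; rewrite scaler0 add0r.
have -> : sqnorm (t *: w) = t ^+ 2 * sqnorm w.
  by rewrite plane_scaleE /sqnorm /=; ring.
by rewrite ler_piMl ?sqnorm_ge0// exprn_ile1.
Qed.

Lemma segment0_line w z : segment 0 w z -> w.2 * z.1 - w.1 * z.2 = 0.
Proof.
by move=> [t _ ->]; rewrite scaler0 add0r plane_scaleE /=; ring.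
Qed.

Lemma sqnorm_polar r phi : sqnorm (r * cos phi, r * sin phi) = r ^+ 2.
Proof.
by rewrite /sqnorm /= !exprMn -mulrDr cos2Dsin2 mulr1.
Qed.

(** * Affine forms and convex sets *)

Definition affine_form (h : plane R -> R) : Prop :=
  forall t z w, h ((1 - t) *: z + t *: w) = (1 - t) * h z + t * h w.

Lemma affine_ray phi : affine_form (ray_form phi).
Proof. by move=> t z w; rewrite plane_combE /ray_form /=; ring. Qed.

Lemma affine_axial phi : affine_form (axial_form phi).
Proof. by move=> t z w; rewrite plane_combE /axial_form /=; ring. Qed.

Definition segment_closed (A : set (plane R)) : Prop :=
  forall z w, A z -> A w -> segment z w `<=` A.

Lemma convex_segment_closed (A : set (plane R)) :
  convex_set (M := plane R) A -> segment_closed A.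
Proof.
move=> cA z w Az Aw _ [t /andP[t0 t1] ->].
have := cA w z (Itv01 t0 t1) (mem_set Aw) (mem_set Az).
by move/set_mem; rewrite /conv /= addrC.
Qed.

Lemma feasible_segment_closed n m (f g : 'cV[R]_n -> R) (a b c : 'cV[R]_m) :
  convex_set (M := plane R) (joint_range f g) ->
  segment_closed (feasible f g a b c).
Proof.
move=> /convex_segment_closed cC z w [Cz hz] [Cw hw] y zwy.
split; first exact: (cC z w).
move: zwy => [t /andP[t0 t1] ->] i.
have := ler_wpM2l t0 (hw i).
have t1' : 0 <= 1 - t by rewrite subr_ge0.
have := ler_wpM2l t1' (hz i).
by rewrite plane_combE /=; nra.
Qed.

(** Moving from [z] towards [w], stop where [h] vanishes if it would become
    negative; an affine form nonnegative at both ends stays so. *)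
Lemma affine_cut (A : set (plane R)) h z w : segment_closed A ->
  affine_form h -> A z -> A w -> 0 <= h z ->
  exists y, [/\ A y, 0 <= h y, y = w \/ h y = 0
    & forall k, affine_form k -> 0 <= k z -> 0 <= k w -> 0 <= k y].
Proof.
move=> cA ah Az Aw hz; have [hw|hw] := leP 0 (h w).
  by exists w; split => //; left.
have D0 : 0 < h z - h w by rewrite subr_gt0 (lt_le_trans hw).
pose t := h z / (h z - h w).
have t0 : 0 <= t by rewrite divr_ge0// ltW.
have t1 : t <= 1 by rewrite ler_pdivrMr// mul1r; lra.
have hy : h ((1 - t) *: z + t *: w) = 0.
  by rewrite ah /t; field; rewrite gt_eqF.
exists ((1 - t) *: z + t *: w); split.
- by apply: (cA z w) => //; exists t; rewrite ?t0.
- by rewrite hy.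
- by right.
- by move=> k ak kz kw; rewrite ak addr_ge0// mulr_ge0// subr_ge0.
Qed.

(** A convex set with a point in a triangle and a point outside it meets one
    of the three sides. *)
Lemma triangle_exit (A : set (plane R)) h1 h2 h3 z w : segment_closed A ->
  affine_form h1 -> affine_form h2 -> affine_form h3 ->
  A z -> 0 <= h1 z -> 0 <= h2 z -> 0 <= h3 z ->
  A w -> ~ [/\ 0 <= h1 w, 0 <= h2 w & 0 <= h3 w] ->
  exists y, [/\ A y, 0 <= h1 y, 0 <= h2 y, 0 <= h3 y
    & [\/ h1 y = 0, h2 y = 0 | h3 y = 0]].
Proof.
move=> cA a1 a2 a3 Az z1 z2 z3 Aw w_out.
have [y1 [Ay1 y11 e1 _]] := affine_cut cA a1 Az Aw z1.
have [y2 [Ay2 y22 e2 /(_ h1 a1 z1 y11) y21]] := affine_cut cA a2 Az Ay1 z2.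
have [y3 [Ay3 y33 e3 keep]] := affine_cut cA a3 Az Ay2 z3.
have y31 := keep h1 a1 z1 y21; have y32 := keep h2 a2 z2 y22.
exists y3; split=> //; case: e3 => [e3|]; last by constructor 3.
case: e2 => [e2|e2]; last by constructor 2; rewrite e3.
case: e1 => [e1|e1]; last by constructor 1; rewrite e3 e2.
by exfalso; apply: w_out; rewrite -e1 -e2 -e3.
Qed.

(** * Points of least norm of a convex set *)

Definition least_norm (A : set (plane R)) z : Prop :=
  A z /\ forall w, A w -> sqnorm z <= sqnorm w.

Lemma value_attained (A : set (plane R)) z :
  A z -> (sqnorm z)%:E = value A -> least_norm A z.
Proof.
move=> Az zA; split=> // w Aw.
by rewrite -lee_fin zA; apply: ereal_inf_lbound; exists w.
Qed.

(** The variational inequality [z . (w - z) >= 0], in the form in which it is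
    used: the angle at [z] between the origin and [w] is not acute. *)
Lemma least_norm_gap (A : set (plane R)) z w : segment_closed A ->
  least_norm A z -> A w -> sqnorm z + sqnorm (w - z) <= sqnorm w.
Proof.
move=> cA [Az minz] Aw.
pose ip := z.1 * (w.1 - z.1) + z.2 * (w.2 - z.2).
have wE : sqnorm w = sqnorm z + 2 * ip + sqnorm (w - z).
  by rewrite /sqnorm /ip /=; ring.
suff ip0 : 0 <= ip by rewrite wE; lra.
rewrite leNgt; apply/negP => ip0.
have d0 := sqnorm_ge0 (w - z).
(* the squared norm at parameter t is [sqnorm z + 2 t ip + t^2 sqnorm (w-z)];
   this t makes the sum of the last two terms negative *)
pose t := - ip / (sqnorm (w - z) - ip).
have D0 : 0 < sqnorm (w - z) - ip by lra.
have t0 : 0 < t by rewrite divr_gt0//; lra.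
have t1 : t <= 1 by rewrite ler_pdivrMr// mul1r; lra.
have Ay : A ((1 - t) *: z + t *: w).
  by apply: (cA z w) => //; exists t; rewrite ?(ltW t0).
have := minz _ Ay.
have -> : sqnorm ((1 - t) *: z + t *: w)
    = sqnorm z + t * (2 * ip + t * sqnorm (w - z)).
  by rewrite plane_combE /sqnorm /ip /=; ring.
apply/negP; rewrite -ltNge -subr_lt0 addrAC subrr add0r pmulr_rlt0//.
have : t * (sqnorm (w - z) - ip) = - ip by rewrite /t; field; rewrite gt_eqF.
have : t * ip < 0 by rewrite pmulr_rlt0.
by lra.
Qed.

Lemma least_norm_lt (A : set (plane R)) z w : segment_closed A ->
  least_norm A z -> A w -> w <> z -> sqnorm z < sqnorm w.
Proof.
move=> cA lnz Aw wz; have := least_norm_gap cA lnz Aw.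
apply: lt_le_trans; rewrite ltrDl lt_neqAle sqnorm_ge0 andbT eq_sym.
apply/eqP => /eqP; rewrite paddr_eq0 ?sqr_ge0// !sqrf_eq0 /= !subr_eq0.
case: w z wz {lnz Aw} => [w1 w2] [z1 z2] /= wz /andP[/eqP ? /eqP ?].
by apply: wz; congr (_, _).
Qed.

(** If [z] lay outside the closed half-plane, the points of [B] in it would
    stay away from [z], and by [least_norm_gap] their norms away from the
    minimum, so that the infimum over the half-plane would be larger. *)
Lemma least_norm_half_plane (A B : set (plane R)) z phi : segment_closed A ->
  least_norm A z -> B `<=` A ->
  (value (B `&` [set y | (0 <= ray_form phi y)%R]) <= (sqnorm z)%:E)%E ->
  0 <= ray_form phi z.
Proof.
move=> cA lnz BA; apply: contraTT; rewrite -!ltNge => rz.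
have gap0 : 0 < ray_form phi z ^+ 2 by rewrite exprn_even_gt0//= lt_eqF.
apply: (@lt_le_trans _ _ (sqnorm z + ray_form phi z ^+ 2)%:E).
  by rewrite lte_fin ltrDl.
apply: le_ereal_inf_tmp => _ [y [By /= ry] <-]; rewrite lee_fin.
apply: (le_trans _ (least_norm_gap cA lnz (BA _ By))).
rewrite lerD2l (sqnorm_frame phi).
have -> : ray_form phi (y - z) = ray_form phi y - ray_form phi z.
  by rewrite /ray_form /=; ring.
have := sqr_ge0 (axial_form phi (y - z)).
by nra.
Qed.

End Coordinates.

(** * Nearest points *)

Section Nearest.
Context {R : realType}.
Implicit Types (y z w : plane R) (S : set (plane R)).

Lemma closed_line (p q c : R) :
  closed [set z : plane R | p * z.1 + q * z.2 = c].
Proof.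
apply: (@preimage_closed _ _ (fun z : plane R => p * z.1 + q * z.2 : R)
  [set x | x = c]); last exact: closed_eq.
move=> z _; apply: (@continuousD R R^o (plane R)); apply: continuousM.
- exact: cst_continuous.
- exact: cvg_fst.
- exact: cst_continuous.
- exact: cvg_snd.
Qed.

Lemma sqnormB_continuous y : continuous (fun z : plane R => sqnorm (z - y) : R).
Proof.
move=> z; rewrite /sqnorm /=.
have e1 : {for z, continuous (fun x : plane R => x.1 - y.1 : R)}.
  apply: (@continuousB R R^o (plane R)); first exact: cvg_fst.
  exact: cst_continuous.
have e2 : {for z, continuous (fun x : plane R => x.2 - y.2 : R)}.
  apply: (@continuousB R R^o (plane R)); first exact: cvg_snd.
  exact: cst_continuous.
by apply: (@continuousD R R^o (plane R)); apply: continuousM.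
Qed.

Lemma nearest_exists S y : closed S -> S !=set0 -> exists z, nearest S y z.
Proof.
move=> cS [w Sw]; set r := sqnorm (w - y).
pose B : set (plane R) := S `&` [set z | sqnorm (z - y) <= r].
have Bw : B w by split => //=.
have cB : compact B.
  apply: (@subclosed_compact _ _
    (`[y.1 - (r + 1), y.1 + (r + 1)] `*` `[y.2 - (r + 1), y.2 + (r + 1)])).
  - apply: closedI => //.
    apply: (@preimage_closed _ _ (fun z : plane R => sqnorm (z - y) : R)
      [set x | x <= r]); last exact: closed_le.
    by move=> z _; exact: sqnormB_continuous.
  - by apply: compact_setX; exact: segment_compact.
  - have absq (x : R) : - (x ^+ 2 + 1) <= x <= x ^+ 2 + 1 by nra.
    move=> z [_ /=]; rewrite /sqnorm /= => zr.
    have /andP[? ?] := absq (z.1 - y.1); have /andP[? ?] := absq (z.2 - y.2).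
    have ? := sqr_ge0 (z.1 - y.1); have ? := sqr_ge0 (z.2 - y.2).
    by split; rewrite /= in_itv /=; apply/andP; split; lra.
have [z /set_mem[Sz zr] zmin] := compact_EVT_min (ex_intro _ w Bw) cB
  (continuous_subspaceT (@sqnormB_continuous y)).
exists z; split=> // x Sx.
have [xr|/ltW rx] := leP (sqnorm (x - y)) r; last exact: le_trans rx.
by apply: zmin; apply/mem_set; split.
Qed.

Lemma nearest_sqnorm_le S w z : nearest S 0 z -> S w -> sqnorm z <= sqnorm w.
Proof. by move=> [_ zmin] /zmin; rewrite !subr0. Qed.

(** Pythagoras: on the tangent at [(r cos phi, r sin phi)] to the circle of
    radius [r] about the origin, the norm grows with the distance to the
    point of contact. *)
Lemma sqnorm_tangent (r phi : R) z : axial_form phi z = r ->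
  sqnorm z = r ^+ 2 + sqnorm (z - (r * cos phi, r * sin phi)).
Proof.
move=> zr; rewrite (sqnorm_frame phi z) (sqnorm_frame phi (z - _)) zr.
have -> : axial_form phi (z - (r * cos phi, r * sin phi)) =
    axial_form phi z - r * (cos phi ^+ 2 + sin phi ^+ 2).
  by rewrite /axial_form /=; ring.
have -> : ray_form phi (z - (r * cos phi, r * sin phi)) = ray_form phi z.
  by rewrite /ray_form /=; ring.
by rewrite cos2Dsin2 zr; ring.
Qed.

End Nearest.

(** * The triangle over a circular sector *)

Section Sector.
Context {R : realType}.
Implicit Types (z w : plane R) (s u d : R).

(** The two rays at angle [d < pi / 2] put the points of the triangle within
    angle [d] of the direction [u], where the norm is at most the coordinate
    along [u] divided by [cos d]. *)
Lemma triangle_sqnorm s u d z : 0 < cos d -> 0 < sin d ->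
  0 <= ray_form u z -> ray_form (u - d) z <= 0 -> axial_form u z <= s ->
  0 <= axial_form u z /\ sqnorm z <= (s / cos d) ^+ 2.
Proof.
move=> c0 s0 y0; rewrite ray_formB subr_le0 => le_yx xs.
set x := axial_form u z in le_yx xs *; set y := ray_form u z in y0 le_yx.
have x0 : 0 <= x.
  by rewrite -(pmulr_rge0 _ s0) (le_trans _ le_yx)// mulr_ge0// ltW.
split=> //; rewrite (sqnorm_frame u) -/x -/y expr_div_n.
rewrite ler_pdivlMr ?exprn_gt0//.
apply: (@le_trans _ _ (x ^+ 2)); last by rewrite lerXn2r// nnegrE (le_trans x0).
have xE : x ^+ 2 = x ^+ 2 * cos d ^+ 2 + (sin d * x) ^+ 2.
  by rewrite -[LHS]mulr1 -(cos2Dsin2 d); ring.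
rewrite mulrDl [leRHS]xE lerD2l -exprMn mulrC.
by rewrite lerXn2r// nnegrE mulr_ge0// ltW.
Qed.

(** The rays of directions [u - d] and [u] and the tangent to the circle of
    radius [s] at its point of direction [u] bound a triangle.  A convex set
    with a point in the disc between the rays and a point too far away to be
    in the triangle leaves it through one of its sides, hence through the
    tangent if it misses the other two. *)
Lemma tangent_side_met (A : set (plane R)) s u d z w : segment_closed A ->
  0 < s -> 0 < cos d -> 0 < sin d ->
  A z -> sqnorm z <= s ^+ 2 -> 0 <= ray_form u z -> ray_form (u - d) z <= 0 ->
  A w -> (s / cos d) ^+ 2 < sqnorm w ->
  ~ (segment 0 (s * cos u, s * sin u) `&` A !=set0) ->
  ~ (segment 0 (s / cos d * cos (u - d), s / cos d * sin (u - d)) `&` A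
     !=set0) ->
  exists y, [/\ A y, axial_form u y = s & sqnorm y <= (s / cos d) ^+ 2].
Proof.
move=> cA s0 c0 sn0 Az zs zu zl Aw w_far missu missl.
have al : affine_form (fun y => - ray_form (u - d) y).
  by move=> t x y; rewrite affine_ray; ring.
have ax : affine_form (fun y => s - axial_form u y).
  by move=> t x y; rewrite affine_axial; ring.
have zx : axial_form u z <= s.
  have := sqr_ge0 (ray_form u z); have := zs; rewrite (sqnorm_frame u); nra.
have [|||y [Ay yu yl yx side]] :=
  triangle_exit cA (@affine_ray R u) al ax Az zu _ _ Aw.
- by rewrite oppr_ge0.
- by rewrite subr_ge0.
- move=> [wu]; rewrite oppr_ge0 subr_ge0 => wl wx.
  have [_] := triangle_sqnorm c0 sn0 wu wl wx.
  by rewrite leNgt w_far.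
move: yl yx; rewrite oppr_ge0 subr_ge0 => yl yx.
have [x0 yF] := triangle_sqnorm c0 sn0 yu yl yx.
exists y; split=> //; case: side => side.
- exfalso; apply: missu; exists y; split=> //.
  by apply: segment_rayP => //; rewrite x0.
- exfalso; apply: missl; exists y; split=> //.
  have lx : axial_form u y = cos d * axial_form (u - d) y.
    have /eqP := side; rewrite oppr_eq0 ray_formB subr_eq0 => /eqP yx0.
    rewrite axial_formB mulrDr !mulrA (mulrC (cos d) (sin d)).
    rewrite -[_ * _ * ray_form _ _]mulrA yx0.
    by rewrite -[LHS]mul1r -(cos2Dsin2 d); ring.
  apply: segment_rayP; first by rewrite divr_gt0.
    by apply/eqP; rewrite -oppr_eq0 side.
  by rewrite ler_pdivlMr// mulrC -lx yx andbT -(pmulr_rge0 _ c0) -lx.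
- by apply/eqP; rewrite eq_sym -subr_eq0 side.
Qed.

End Sector.

(** * Invariants of the bisection *)

Section Bisection.
Context {R : realType}.
Variable Omega : set (plane R).
Implicit Types (z y : plane R) (k : nat).

Lemma bisectionS k :
  bisection Omega k.+1 = bisection_step (value Omega) (bisection Omega k).
Proof. by []. Qed.

Lemma bisection_dom_sub k : dom (bisection Omega k) `<=` Omega.
Proof.
elim: k => [//|k IH] z; rewrite bisectionS /bisection_step.
by case: ifP => _ [/IH].
Qed.

Lemma bisection_width k :
  up (bisection Omega k) - lo (bisection Omega k) = 2 * pi / 2 ^+ k.
Proof.
elim: k => [|k IH]; first by rewrite subr0 expr0 divr1.
rewrite exprSr invfM mulrA -IH bisectionS /bisection_step.
by case: ifP => _ /=; lra.
Qed.

(** The claim fails before the first step: for the ends [0] and [2 * pi] the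
    two inequalities leave only the line [y.2 = 0].  At the angle [pi] each
    choice of half-plane gives both of them at once; every later step imposes
    the inequality of the end that it moves. *)
Lemma bisection_wedge k y : dom (bisection Omega k.+1) y ->
  ray_form (lo (bisection Omega k.+1)) y <= 0 <=
  ray_form (up (bisection Omega k.+1)) y.
Proof.
elim: k => [|k IH]; rewrite bisectionS /bisection_step.
  have -> : (lo (bisection Omega 0) + up (bisection Omega 0)) / 2 = pi.
    by rewrite /=; lra.
  case: ifP => _ /= [_]; rewrite ray_formpi ?ray_form0 ?ray_form2pi.
    by rewrite oppr_le0 => ->.
  by rewrite oppr_ge0 => ->.
by case: ifP => _ /= [/IH/andP[yl yu] yphi]; rewrite ?yl ?yu yphi.
Qed.

Lemma bisection_keeps_least_norm z k : segment_closed Omega ->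
  least_norm Omega z -> (sqnorm z)%:E = value Omega ->
  dom (bisection Omega k) z.
Proof.
move=> cO lnz zv; elim: k => [|k IH]; first by case: lnz.
rewrite bisectionS /bisection_step; set phi := (_ + _) / 2.
case: ifPn => [le_v|/negP lt_v] /=; split=> //=.
  by apply: least_norm_half_plane cO lnz (@bisection_dom_sub k) _; rewrite zv.
rewrite leNgt; apply/negP => /ltW zphi; apply: lt_v.
by rewrite -zv; apply: ereal_inf_lbound; exists z.
Qed.

End Bisection.

(** * The number of steps *)

Section Stopping.
Context {R : realType}.
Implicit Types (vbar eps : R).

Lemma angle_tol_bounds vbar eps : 0 <= vbar -> 0 < eps ->
  [/\ 0 < angle_tol vbar eps, angle_tol vbar eps <= pi / 2
    & cos (angle_tol vbar eps) = Num.sqrt vbar / Num.sqrt (vbar + eps / 2)].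
Proof.
move=> v0 e0; rewrite /angle_tol; set x := _ / _.
have D0 : 0 < Num.sqrt (vbar + eps / 2) by rewrite sqrtr_gt0; lra.
have x0 : 0 <= x by rewrite divr_ge0// sqrtr_ge0.
have x1 : x < 1.
  by rewrite ltr_pdivrMr// mul1r ltr_sqrt; lra.
have xI : -1 <= x <= 1 by lra.
have [/andP[a0 api] cx] := acos_def xI.
split=> //; first by apply: acos_gt0; lra.
rewrite leNgt; apply/negP => lt_a.
have : cos (acos x) < cos (pi / 2).
  rewrite ltr_cos// in_itv /= ?a0 ?api//; have := pi_gt0 R; lra.
by rewrite cx cos_pihalf ltNge x0.
Qed.

Lemma width_le_angle_tol vbar eps k : 0 <= vbar -> 0 < eps ->
  (2 * pi / 2 ^+ k <= angle_tol vbar eps) = (log2_ratio vbar eps <= k%:R).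
Proof.
move=> v0 e0; have [t0 _ _] := angle_tol_bounds v0 e0.
have ln2 : 0 < ln 2 :> R by rewrite ln_gt0// ltr1n.
have pi2 : 0 < 2 * pi :> R by rewrite mulr_gt0// pi_gt0.
rewrite /log2_ratio ler_pdivrMr ?exprn_gt0// [_ * 2 ^+ k]mulrC -ler_pdivrMr//.
rewrite [RHS]ler_pdivrMr// [k%:R * _]mulr_natl -lnXn//.
by rewrite ler_ln// posrE ?divr_gt0 ?exprn_gt0.
Qed.

Lemma log2_ratio_gt1 vbar eps : 0 <= vbar -> 0 < eps ->
  1 < log2_ratio vbar eps.
Proof.
move=> v0 e0; have [t0 tpi _] := angle_tol_bounds v0 e0.
rewrite ltNge -[1]/(1%:R) -(width_le_angle_tol 1 v0 e0) -ltNge expr1.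
by have := pi_gt0 R; lra.
Qed.

(** By [width_le_angle_tol] the stopping test at step [k] reads
    [log2_ratio vbar eps <= k], so it first succeeds at the ceiling, which is
    positive because [log2_ratio] exceeds [1]. *)
Lemma stops_after_ceil (Omega : set (plane R)) vbar eps :
  0 <= vbar -> 0 < eps ->
  stops_after Omega vbar eps `|Num.ceil (log2_ratio vbar eps)|%N.
Proof.
move=> v0 e0; have l1 := log2_ratio_gt1 v0 e0.
set K := `|_|%N; have KE : K%:Z = Num.ceil (log2_ratio vbar eps).
  by rewrite /K gez0_abs// ceil_ge0; lra.
have widthE k : `|up (bisection Omega k) - lo (bisection Omega k)|
    = 2 * pi / 2 ^+ k :> R.
  by rewrite bisection_width ger0_norm// divr_ge0 ?mulr_ge0 ?exprn_ge0 ?pi_ge0.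
have stopE k : (2 * pi / 2 ^+ k <= angle_tol vbar eps) = (K <= k)%N.
  by rewrite width_le_angle_tol// -lez_nat KE ceil_le_int.
split.
- by rewrite ltnNge -stopE width_le_angle_tol//= -ltNge; lra.
- by move=> k /andP[_ kK]; rewrite widthE ltNge stopE -ltnNge.
- by rewrite widthE stopE.
Qed.

End Stopping.

(** * The reported point *)

Section Report.
Context {R : realType}.
Implicit Types (vbar eps : R) (z w y : plane R) (S : set (plane R)).

Lemma cos_angle_tol_le vbar eps d : 0 <= vbar -> 0 < eps ->
  0 <= d <= angle_tol vbar eps ->
  Num.sqrt vbar / Num.sqrt (vbar + eps / 2) <= cos d.
Proof.
move=> v0 e0 /andP[d0 dt]; have [t0 tpi <-] := angle_tol_bounds v0 e0.
have p0 := pi_gt0 R; rewrite leNgt; apply/negP.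
by rewrite ltr_cos ?in_itv /=; lra.
Qed.

(** For [vbar = 0] the cosine may vanish, but then so does the numerator. *)
Lemma sec_sqr_le vbar eps d : 0 <= vbar -> 0 < eps ->
  0 <= d <= angle_tol vbar eps ->
  (Num.sqrt vbar / cos d) ^+ 2 <= vbar + eps / 2.
Proof.
move=> v0 e0 dt; have := cos_angle_tol_le v0 e0 dt.
have [->|vn0] := eqVneq vbar 0.
  by move=> _; rewrite sqrtr0 mul0r expr0n /=; lra.
have vp : 0 < vbar by rewrite lt_neqAle eq_sym vn0.
have D0 : 0 < Num.sqrt (vbar + eps / 2) by rewrite sqrtr_gt0; lra.
have s0 : 0 < Num.sqrt vbar by rewrite sqrtr_gt0.
move=> le_c; have c0 : 0 < cos d by apply: lt_le_trans le_c; rewrite divr_gt0.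
have DE : Num.sqrt (vbar + eps / 2) ^+ 2 = vbar + eps / 2.
  by rewrite sqr_sqrtr//; lra.
rewrite -DE lerXn2r// ?nnegrE; [by rewrite divr_ge0// ltW|exact: ltW|].
by move: le_c; rewrite !ler_pdivrMr// mulrC.
Qed.

Lemma final_search_sub (Omega : set (plane R)) vbar k S y :
  final_search Omega vbar k S y -> S `<=` Omega.
Proof. by case=> [[_ -> _]|[_ -> _]|[_ _ -> _]] z []. Qed.

Lemma final_search_closed (Omega : set (plane R)) vbar k S y :
  final_search Omega vbar k S y -> closed Omega -> closed S.
Proof.
move=> fs cO.
have lineE (w : plane R) : [set z : plane R | w.2 * z.1 - w.1 * z.2 = 0] =
    [set z : plane R | w.2 * z.1 + - w.1 * z.2 = 0].
  by apply/seteqP; split=> z /=; rewrite mulNr.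
case: fs => [[_ -> _]|[_ -> _]|[_ _ -> _]];
  by apply: closedI => //; rewrite ?lineE; exact: closed_line.
Qed.

(** In each of the three cases the set searched contains a point [x] close
    enough in norm to the optimum, and the point nearest to [y] is at most as
    far from the origin as [x]: directly when [y] is the origin, by Pythagoras
    when the set lies on the tangent.  The point [w], out of reach of the
    triangle, rules out that the feasible set shrinks to an island inside it. *)
Lemma final_search_target (Omega : set (plane R)) z w vbar eps k S y :
  segment_closed Omega -> least_norm Omega z -> (sqnorm z)%:E = value Omega ->
  Omega w -> sqnorm z + eps < sqnorm w ->
  0 < eps -> sqnorm z <= vbar <= sqnorm z + eps / 2 ->
  (0 < k)%N -> 2 * pi / 2 ^+ k <= angle_tol vbar eps ->
  final_search Omega vbar k S y ->
  exists x, [/\ S x, sqnorm x <= sqnorm z + eps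
    & forall zbar, nearest S y zbar -> sqnorm zbar <= sqnorm x].
Proof.
move=> cO lnz zv Ow w_far e0 /andP[zvb vbz] k0 dt.
have z0 := sqnorm_ge0 z; have v0 : 0 <= vbar := le_trans z0 zvb.
set d := 2 * pi / 2 ^+ k in dt.
have d0 : 0 < d by rewrite divr_gt0 ?mulr_gt0 ?exprn_gt0 ?pi_gt0.
have dI : 0 <= d <= angle_tol vbar eps by rewrite ltW.
have sec_le := sec_sqr_le v0 e0 dI.
have svb : Num.sqrt vbar ^+ 2 = vbar := sqr_sqrtr v0.
set u := up (bisection Omega k).
have lE : lo (bisection Omega k) = u - d.
  by rewrite /d -(bisection_width Omega k) subKr.
rewrite /final_search /zhat /zcheck /= -/u -/d lE.
case=> [[[x [xs Ox]] -> ->]|[[x [xs Ox]] -> ->]|[missu missl -> ->]].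
- have xl := segment0_line xs; have := sqnorm_segment0 xs.
  rewrite sqnorm_polar svb => xle; exists x; split=> //; first by lra.
  by move=> zbar /nearest_sqnorm_le; apply.
- have xl := segment0_line xs; have := sqnorm_segment0 xs.
  rewrite sqnorm_polar => xle; exists x; split=> //; first by lra.
  by move=> zbar /nearest_sqnorm_le; apply.
have Oz : Omega z by case: lnz.
have vp : 0 < vbar.
  rewrite lt_neqAle v0 andbT eq_sym; apply/eqP => vb0; apply: missu.
  have z_0 : z = 0.
    have : sqnorm z <= 0 by rewrite -vb0.
    rewrite /sqnorm => zz.
    have /eqP : z.1 ^+ 2 + z.2 ^+ 2 = 0 by apply/eqP; rewrite eq_le zz.
    rewrite paddr_eq0 ?sqr_ge0// !sqrf_eq0 => /andP[/eqP z1 /eqP z2].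
    by rewrite [LHS]surjective_pairing z1 z2.
  exists z; split=> //; exists 0; first by rewrite lexx ler01.
  by rewrite scale0r scaler0 addr0.
have s0 : 0 < Num.sqrt vbar by rewrite sqrtr_gt0.
have cd : 0 < cos d.
  apply: lt_le_trans (cos_angle_tol_le v0 e0 dI).
  by rewrite divr_gt0// sqrtr_gt0; lra.
have sd : 0 < sin d.
  have [_ tpi _] := angle_tol_bounds v0 e0.
  by apply: sin_gt0_pi; have := pi_gt0 R; lra.
have := bisection_keeps_least_norm k cO lnz zv.
rewrite -(prednK k0) => /bisection_wedge; rewrite prednK// -/u lE.
move=> /andP[zl zu].
have [||x [Ox xu xF]] :=
  tangent_side_met cO s0 cd sd Oz _ zu zl Ow _ missu missl.
- by rewrite svb.
- by lra.
have tangentE y' : axial_form u y' = Num.sqrt vbar <->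
    Num.sqrt vbar * cos u * y'.1 + Num.sqrt vbar * sin u * y'.2 = vbar.
  rewrite -!mulrA -mulrDr -/(axial_form u y') -[in X in _ <-> _ = X]svb expr2.
  by split=> [->//|]; apply: mulfI; rewrite gt_eqF.
exists x; split; first by split=> //=; exact/tangentE.
  by lra.
move=> zbar [[/tangentE zu' _] /(_ x)].
rewrite /= (sqnorm_tangent zu') (sqnorm_tangent xu) lerD2l.
by apply; split=> //; exact/tangentE.
Qed.

(** A point is compact, hence bounded, and a ball contains more than one. *)
Lemma nondegenerate_two_points (A : set (plane R)) z : A z ->
  ~ bounded_set A \/ interior A !=set0 -> exists2 w, A w & w <> z.
Proof.
move=> Az nd; apply: contrapT => single.
have onlyz w : A w -> w = z.
  by move=> Aw; apply: contrapT => wz; apply: single; exists w.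
have Az1 : A = [set z] by apply/seteqP; split=> [w /onlyz|w ->].
rewrite {}Az1 in nd; case: nd => [|[y]].
  by apply; apply: compact_bounded; exact: compact_set1.
rewrite /interior /= => /nbhs_ballP[e /= e0 ball_z].
have yz : y = z by apply: ball_z; exact: ballxx.
have : ball y e (y.1 + e / 2, y.2).
  split=> /=; last exact: ballxx.
  by rewrite /ball /= opprD addrA subrr add0r normrN gtr0_norm; lra.
by move=> /ball_z /=; rewrite -yz => /(congr1 fst) /=; lra.
Qed.

End Report.

Theorem theorem4 (R : realType) (n m : nat)
    (P Q : 'M[R]_n) (p q : 'cV[R]_n) (p0 q0 : R) (a b c : 'cV[R]_m)
    (P_sym : P^T = P) (Q_sym : Q^T = Q) :
  let f := quadratic P p p0 in
  let g := quadratic Q q q0 in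
  let Omega0 := feasible f g a b c in
  forall (C_convex : convex_set (joint_range f g))
    (attained : exists2 zstar, Omega0 zstar & (sqnorm zstar)%:E = value Omega0)
    (nondegenerate : ~ bounded_set Omega0 \/ interior Omega0 !=set0),
  exists2 eps0 : R, 0 < eps0 &
    forall eps vbar : R, 0 < eps < eps0 ->
      (value Omega0 <= vbar%:E <= value Omega0 + (eps / 2)%:E)%E ->
      exists K : nat,
        [/\ stops_after Omega0 vbar eps K,
            K%:Z = (if log2_ratio vbar eps \is a Num.int
                    then kstar vbar eps - 1 else kstar vbar eps)
          & forall S y, final_search Omega0 vbar K S y ->
            [/\ S !=set0,
                closed Omega0 -> exists zbar, nearest S y zbar
              & forall zbar, nearest S y zbar ->
                Omega0 zbar /\
                (value Omega0 <= (sqnorm zbar)%:E <= value Omega0 + eps%:E)%E]].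
Proof.
move=> f g Omega0 C_convex [z Oz zv] nondegenerate.
have cO : segment_closed Omega0 by exact: feasible_segment_closed.
have lnz := value_attained Oz zv.
have [w Ow wz] := nondegenerate_two_points Oz nondegenerate.
exists (sqnorm w - sqnorm z).
  by rewrite subr_gt0; exact: least_norm_lt cO lnz Ow wz.
move=> eps vbar /andP[e0 eps_small].
rewrite -zv -!EFinD !lee_fin => vbar_bounds.
have /andP[zvb _] := vbar_bounds.
have v0 : 0 <= vbar := le_trans (sqnorm_ge0 z) zvb.
have stop := stops_after_ceil Omega0 v0 e0.
exists `|Num.ceil (log2_ratio vbar eps)|%N; split=> //.
  have l1 := log2_ratio_gt1 v0 e0.
  rewrite gez0_abs ?ceil_ge0; last by lra.
  by rewrite ceil_floor /kstar; case: ifP => _; rewrite ?addrK ?addr0.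
case: stop; set K := `|_|%N => K0 _ width_small S y fs.
have width_tol : 2 * pi / 2 ^+ K <= angle_tol vbar eps.
  rewrite -(bisection_width Omega0).
  exact: le_trans (ler_norm _) width_small.
have w_far : sqnorm z + eps < sqnorm w by lra.
have [x [Sx xF near_x]] :=
  final_search_target cO lnz zv Ow w_far e0 vbar_bounds K0 width_tol fs.
split; first by exists x.
  by move=> /(final_search_closed fs) cS; apply: nearest_exists => //; exists x.
move=> zbar near_zbar; have Ozbar := final_search_sub fs near_zbar.1.
split=> //; rewrite !lee_fin (lnz.2 _ Ozbar) /=.
exact: le_trans (near_x _ near_zbar) xF.
Qed.
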